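(* Fix a positive integer $r$ and let $U$ be a random variable taking values in the space of locally finite rooted trees of height at most $r$. Suppose there is some constant $k$ such that $\mathbf{E}N(U;t)\le e^{k|t|}$ for all finite rooted trees $t$ of height at most $r$. Then the law of $U$ is uniquely determined by the values of $\mathbf{E}N(U;t)$ as $t$ varies over finite rooted trees of height at most $r$ (that is, any random rooted tree $U'$ of this kind with $\mathbf{E}N(U';t)=\mathbf{E}N(U;t)$ for all such $t$ has the same law as $U$).
   Context: Rooted trees are identified up to rooted isomorphism; $|t|$ denotes the number of vertices of $t$. For a finite rooted tree $t$ and a rooted graph (in particular a rooted tree) $u$, a tree-map from $t$ to $u$ is an injective map from the vertices of $t$ to the vertices of $u$ sending root to root and adjacent vertices to adjacent vertices. $N(u;t)$ is the number of distinct tree-maps from $t$ to $u$. *)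

(* Defs.v *)
From HB Require Import structures.
From mathcomp Require Import all_boot all_order all_algebra.
From mathcomp Require Import finmap.
From mathcomp Require Import all_classical all_reals all_analysis.

Set Implicit Arguments.
Unset Strict Implicit.
Unset Printing Implicit Defensive.

Local Open Scope classical_set_scope.

(* The universe of vert ends up strictly below that of choiceType, because
   lf_tree below is made a choiceType; 'I_n is not an admissible carrier, but
   {i : nat | i < n} is.  Locally finite connected graphs are countable, so every
   isomorphism class is represented. *)
Record rooted_graph := RootedGraph {
  vert : Type ;
  root : vert ;
  adj : vert -> vert -> bool ;
  adj_sym : symmetric adj ;
  adj_irr : irreflexive adj }.

HB.instance Definition _ (G : rooted_graph) := gen_eqMixin (vert G).
HB.instance Definition _ (G : rooted_graph) := gen_choiceMixin (vert G).

Section RootedGraph.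
Implicit Types G H t u : rooted_graph.

Definition rooted_iso G H : Prop :=
  exists f : vert G -> vert H,
    [/\ bijective f, f (root G) = root H
      & forall x y, adj (f x) (f y) = adj x y].

Lemma rooted_iso_refl G : rooted_iso G G.
Proof. by exists id; split=> //; exists id. Qed.

Lemma rooted_iso_sym G H : rooted_iso G H -> rooted_iso H G.
Proof.
move=> [f [[g fK gK] f0 fa]]; exists g; split; first by exists f.
  by rewrite -f0 fK.
by move=> x y; rewrite -fa !gK.
Qed.

Lemma rooted_iso_trans G H K :
  rooted_iso G H -> rooted_iso H K -> rooted_iso G K.
Proof.
move=> [f [fb f0 fa]] [g [gb g0 ga]]; exists (g \o f); split.
- exact: bij_comp.
- by rewrite /= f0.
- by move=> x y /=; rewrite ga fa.
Qed.

(* [within n x]: x is at graph distance at most n from the root. *)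
Definition within G (n : nat) (x : vert G) : Prop :=
  exists p : seq (vert G),
    [/\ path (@adj G) (root G) p, last (root G) p = x & (size p <= n)%N].

Definition connected_graph G : Prop := forall x : vert G, exists n, within n x.

Definition acyclic_graph G : Prop :=
  forall c : seq (vert G), (2 < size c)%N -> uniq c -> ~~ cycle (@adj G) c.

Definition is_tree G : Prop := connected_graph G /\ acyclic_graph G.

Definition locally_finite_graph G : Prop :=
  forall x : vert G, finite_set [set y | adj x y].

Definition finite_graph G : Prop := finite_set [set: vert G].

Definition height_le (r : nat) G : Prop := forall x : vert G, within r x.

(* |G|, for finite G *)
Definition num_vert G : nat := #|` fset_set [set: vert G] |%fset.

Definition tree_map t u : set (vert t -> vert u) :=
  [set f : vert t -> vert u |
    [/\ injective f, f (root t) = root u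
             & forall x y, adj x y -> adj (f x) (f y)]].

(* N(u; t).  When t is finite and connected and u is locally finite, the set
   tree_map t u is finite, hence the cardinal below is the genuine one (by
   convention fset_set maps infinite sets to the empty finite set). *)
Definition num_tree_map u t : nat := #|` fset_set (@tree_map t u) |%fset.

Section Ball.
Variables (n : nat) (G : rooted_graph).

Definition ball_vert : Type := {x : vert G | `[< within n x >]}.

Lemma within_root : `[< within n (root G) >].
Proof. by apply/asboolP; exists [::]. Qed.

Definition ball_adj (x y : ball_vert) : bool := adj (val x) (val y).

Lemma ball_adj_sym : symmetric ball_adj.
Proof. by move=> x y; exact: adj_sym. Qed.

Lemma ball_adj_irr : irreflexive ball_adj.
Proof. by move=> x; exact: adj_irr. Qed.

Definition rooted_ball : rooted_graph :=
  @RootedGraph ball_vert (exist _ (root G) within_root : ball_vert)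
    ball_adj ball_adj_sym ball_adj_irr.
End Ball.

End RootedGraph.

Arguments tree_map : clear implicits.

Record lf_tree (r : nat) := LfTree {
  lf_tree_graph :> rooted_graph ;
  lf_treeP : [/\ is_tree lf_tree_graph, locally_finite_graph lf_tree_graph
               & height_le r lf_tree_graph] }.

HB.instance Definition _ r := gen_eqMixin (lf_tree r).
HB.instance Definition _ r := gen_choiceMixin (lf_tree r).

Section TreeSpace.
Variable r : nat.

Definition lf_tree_iso : rel (lf_tree r) := fun u v => `[< rooted_iso u v >].

Lemma lf_tree_iso_refl : reflexive lf_tree_iso.
Proof. by move=> u; apply/asboolP; exact: rooted_iso_refl. Qed.

Lemma lf_tree_iso_sym : symmetric lf_tree_iso.
Proof.
by move=> u v; apply/asboolP/asboolP; exact: rooted_iso_sym.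
Qed.

Lemma lf_tree_iso_trans : transitive lf_tree_iso.
Proof.
move=> v u w /asboolP uv /asboolP vw; apply/asboolP.
exact: rooted_iso_trans uv vw.
Qed.

Canonical lf_tree_equiv :=
  EquivRel lf_tree_iso lf_tree_iso_refl lf_tree_iso_sym lf_tree_iso_trans.

Definition tree_class : choiceType := {eq_quot lf_tree_equiv}%qT.

Definition tree_class_repr (u : tree_class) : lf_tree r := repr u.

Definition point_graph : rooted_graph :=
  @RootedGraph unit tt (fun _ _ => false)
    (fun _ _ => erefl) (fun _ => erefl).

Lemma point_graphP : [/\ is_tree point_graph, locally_finite_graph point_graph
  & height_le r point_graph].
Proof.
have hw n (x : vert point_graph) : within n x by case: x; exists [::].
split; [split | |].
- by move=> x; exists 0%N.
- by case=> [//|[] [//|[] c]].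
- by move=> x; rewrite (_ : [set _ | _] = set0) //; apply/seteqP; split.
- by move=> x; exact: hw.
Qed.

HB.instance Definition _ := Choice.on tree_class.
HB.instance Definition _ := isPointed.Build tree_class
  (\pi_({eq_quot lf_tree_equiv}) (LfTree point_graphP))%qT.

(* The basic clopen sets of the local topology: the trees whose ball of radius
   n about the root is isomorphic to that of a given tree v. *)
Definition local_cylinder (n : nat) (v : tree_class) : set tree_class :=
  [set u | rooted_iso (rooted_ball n (tree_class_repr u))
                      (rooted_ball n (tree_class_repr v))].

Definition local_cylinders : set (set tree_class) :=
  [set A | exists n v, A = local_cylinder n v].

(* The local topology has countably many cylinders, so the sigma-algebra they
   generate is its Borel sigma-algebra. *)
Definition tree_space := g_sigma_algebraType local_cylinders.

HB.instance Definition _ := Measurable.on tree_space.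

(* The graph representing an isomorphism class; num_tree_map does not depend on
   the representative. *)
Definition tree_space_graph (u : tree_space) : rooted_graph :=
  tree_class_repr u.

End TreeSpace.

(* Main.v *)
Require Import Defs.
From HB Require Import structures.
From mathcomp Require Import all_boot all_order all_algebra.
From mathcomp Require Import finmap.
From mathcomp Require Import all_classical all_reals all_analysis.
From mathcomp Require Import measurable_realfun zify ring lra.

Set Implicit Arguments.
Unset Strict Implicit.
Unset Printing Implicit Defensive.
Import Order.TTheory GRing.Theory Num.Theory.
Import numFieldNormedType.Exports.
Local Open Scope classical_set_scope.

(* A locally finite tree of bounded height is finite, so there are countably
   many isomorphism classes and it suffices to recover P(U = u) for each class u.
   Let S_j(v) be the sum of N(v; t) over the trees t obtained from u by attaching
   j labelled leaves.  Since v is acyclic, a tree-map phi : u -> v extends to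
   such trees in exactly b(b-1)...(b-j+1) ways, where b is the number of vertices
   of v outside phi(u) that are adjacent to phi(u).  As sum_j (-1)^j 'C(b, j) is
   the indicator of b = 0, and b = 0 forces phi to be an isomorphism,
   sum_j (-1)^j S_j(U) / j! is a positive constant times the indicator of U = u.
   There are |u|^j summands in S_j, each of mean at most e^(k (|u| + j)), so the
   alternating series can be integrated termwise and its mean is a function of
   the moments. *)

Local Notation root := Defs.root.
Local Notation within := Defs.within.

(** * Tree-maps between trees *)

Section Graphs.
Implicit Types G H : rooted_graph.

Lemma connected_path G (x y : vert G) : connected_graph G ->
  exists p, [/\ path (@adj G) x p, last x p = y & uniq (x :: p)].
Proof.
move=> cG; have [_ [p [pp <- _]]] := cG x; have [_ [q [qp <- _]]] := cG y.
set ro := root G in pp qp *.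
(* The route from [x] to [y] goes back along [p] to the root, then out along [q]; shortening it
   makes it simple. *)
have rpp : path (@adj G) (last ro p) (rev (belast ro p)).
  rewrite rev_path; apply: sub_path pp => a b; by rewrite /= adj_sym.
have lpp : last (last ro p) (rev (belast ro p)) = ro.
  by case: (p) => //= a s; rewrite rev_cons last_rcons.
have : last ro q = last (last ro p) (rev (belast ro p) ++ q) by rewrite last_cat lpp.
have : path (@adj G) (last ro p) (rev (belast ro p) ++ q).
  by rewrite cat_path rpp lpp.
by case/shortenP => s sp su _ ->; exists s.
Qed.

Lemma within_uniq_path G n (x : vert G) : within n x ->
  exists p, [/\ path (@adj G) (root G) p, last (root G) p = x, uniq (root G :: p)
    & (size p <= n)%N].
Proof.
move=> [p [pp <- sp]]; case/shortenP: pp => q qp qu qs; exists q; split=> //.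
apply: leq_trans sp; apply: uniq_leq_size => //.
by case/andP: qu.
Qed.

(* Closing the excursion by the image of a path of [G] would otherwise give a cycle of [H]. *)
Lemma tree_map_excursion G H (phi : vert G -> vert H) x x' q :
  connected_graph G -> acyclic_graph H -> tree_map G H phi -> x != x' ->
  uniq q -> (forall y, phi y \notin q) ->
  path (@adj H) (phi x) (rcons q (phi x')) -> q = [::] /\ adj x x'.
Proof.
move=> cG aH [phi_inj _ phi_adj] xx' q_uniq q_out.
rewrite rcons_path => /andP[q_path q_last].
have [p [p_path p_last p_uniq]] := connected_path x x' cG.
have [big|] := boolP (2 < size (map phi (x :: p) ++ rev q))%N.
  have c_uniq : uniq (map phi (x :: p) ++ rev q).
    rewrite cat_uniq rev_uniq q_uniq map_inj_uniq // p_uniq andbT /=.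
    apply/hasPn => y; rewrite mem_rev => yq; apply/negP => yi.
    have [z _ yz] : exists2 z, z \in x :: p & y = phi z by apply/mapP.
    by move: (q_out z); rewrite -yz yq.
  exfalso; apply: (negP (aH _ big c_uniq)).
  rewrite /= rcons_path cat_path path_map last_map p_last.
  rewrite (sub_path _ p_path); last by move=> a b /=; exact: phi_adj.
  rewrite last_cat last_map p_last /=.
  case/lastP: q q_path q_last {q_uniq q_out big c_uniq} => [|q z] /=.
    by move=> _; rewrite adj_sym.
  rewrite last_rcons rev_rcons /= => zp zx'.
  rewrite adj_sym zx' /=.
  have := rev_path (@adj H) (phi x) (rcons q z).
  rewrite belast_rcons last_rcons rev_cons => h.
  have /= e : path (@adj H) z (rcons (rev q) (phi x)).
    by rewrite h; apply: sub_path zp => a b /=; rewrite adj_sym.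
  by move: e; rewrite rcons_path.
(* With at most two vertices in all, [p] consists of [x'] alone, since [x != x'], and [q] is
   empty. *)
rewrite size_cat size_map size_rev /=.
case: p p_path p_last p_uniq => [_ /= xe|y [|z s]] //=.
  by rewrite xe eqxx in xx'.
rewrite andbT => xy <- _; case: q {q_uniq q_out q_path q_last} => //.
Qed.

(** Cut the path at its first return to the image of [phi]. By [tree_map_excursion] the piece before
    the cut is a single edge coming from an edge of [G]; induct on the rest. *)
Lemma tree_map_lift G H (phi : vert G -> vert H) x p :
  connected_graph G -> acyclic_graph H -> tree_map G H phi ->
  path (@adj H) (phi x) p -> uniq (phi x :: p) ->
  (exists z, last (phi x) p = phi z) ->
  exists2 q, path (@adj G) x q & p = map phi q.
Proof.
move=> cG aH tm; move: {2}(size p) (leqnn (size p)) => n.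
elim: n x p => [|n IHn] x p.
  by rewrite leqn0 size_eq0 => /eqP-> _ _ _; exists [::].
case: p => [|y p]; first by exists [::].
move=> sp pp up [z lz].
set im : pred (vert H) := fun y => `[< exists x, y = phi x >].
have : has im (y :: p).
  apply/hasP; exists (last (phi x) (y :: p)); first by rewrite /= mem_last.
  by apply/asboolP; exists z.
move=> /split_find.
case def_p: _ _ _ / => [y' q p2 /asboolP[x' y'x'] q_out]; subst y'.
rewrite def_p in sp pp up lz.
have xx' : x != x'.
  apply: contraTneq up => ->.
  by rewrite /= mem_cat mem_rcons inE eqxx.
have uq : uniq q.
  by move: up; rewrite /= cat_uniq rcons_uniq => /andP[_ /andP[/andP[]]].
move: (pp); rewrite cat_path last_rcons => /andP[pq pp2].
have qo w : phi w \notin q.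
  by apply: contra q_out => wq; apply/hasP; exists (phi w) => //; apply/asboolP; exists w.
have [q0 xx] := tree_map_excursion cG aH tm xx' uq qo pq; subst q.
have [] := IHn x' p2.
- by move: sp; rewrite /=.
- by [].
- by move: up => /= /andP[_].
- by exists z; rewrite -lz.
move=> q qp ->; exists (x' :: q) => //=.
by rewrite xx.
Qed.

(** A simple path from the root to [phi x] lifts to [G]. In contrapositive form, a tree higher than
    [r] has no tree-map into a tree of height at most [r]. *)
Lemma tree_map_height_le G H (phi : vert G -> vert H) r :
  connected_graph G -> acyclic_graph H -> tree_map G H phi ->
  height_le r H -> height_le r G.
Proof.
move=> cG aH tm hH x; have [p [pp lp up sp]] := within_uniq_path (hH (phi x)).
have [_ phi0 _] := tm; rewrite -phi0 in pp lp up.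
have [|q qp def_p] := tree_map_lift cG aH tm pp up; first by exists x.
exists q; split=> //; last by rewrite def_p size_map in sp.
apply: (let: And3 h _ _ := tm in h).
by rewrite -last_map -def_p lp.
Qed.

(** Otherwise [[:: y]] would be an excursion between distinct vertices. Hence the image of an
    attached leaf determines the vertex that the leaf is attached to. *)
Lemma tree_map_outer_unique G H (phi : vert G -> vert H) y x x' :
  connected_graph G -> acyclic_graph H -> tree_map G H phi ->
  (forall z, phi z != y) -> adj (phi x) y -> adj (phi x') y -> x = x'.
Proof.
move=> cG aH tm yo xy x'y; apply/eqP/negPn/negP => xx'.
have [] // := @tree_map_excursion _ _ _ _ _ [:: y] cG aH tm xx'.
- by move=> z; rewrite inE yo.
- by rewrite /= xy adj_sym x'y.
Qed.

(** Only the reflection of adjacency is at stake: an edge between two image vertices is an excursion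
    with empty interior, so it comes from an edge of [G]. *)
Lemma surjective_tree_map_iso G H (phi : vert G -> vert H) :
  connected_graph G -> acyclic_graph H -> tree_map G H phi ->
  (forall y, exists x, phi x = y) -> rooted_iso G H.
Proof.
move=> cG aH tm sj; have [phi_inj phi0 phi_adj] := tm.
exists phi; split=> //.
  rewrite -setTT_bijective; split=> // [x y _ _|y _]; first exact: phi_inj.
  by have [x] := sj y; exists x.
move=> x y; apply/idP/idP; last exact: phi_adj.
move=> xy; have [exy|nxy] := eqVneq x y; first by rewrite exy adj_irr in xy.
have [] // := @tree_map_excursion _ _ _ _ _ [::] cG aH tm nxy.
by rewrite /= xy.
Qed.

(** This turns b = 0 into surjectivity: the image contains the root and is closed under adjacency,
    so it absorbs every path from the root. *)
Lemma connected_closed_surj G H (phi : vert G -> vert H) :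
  connected_graph H -> phi (root G) = root H ->
  (forall x y, adj (phi x) y -> exists x', phi x' = y) ->
  forall y, exists x, phi x = y.
Proof.
move=> cH phi0 cl y; have [_ [p [pp <- _]]] := cH y.
elim/last_ind: p pp => [|p z IH]; first by exists (root G).
rewrite rcons_path last_rcons => /andP[/IH[x <-]]; exact: cl.
Qed.

(** Induction on the radius: a vertex within distance n + 1 is the root or adjacent to a vertex
    within distance n. *)
Lemma finite_height_le G r : locally_finite_graph G -> height_le r G -> finite_graph G.
Proof.
move=> lf hG; rewrite /finite_graph.
have -> : [set: vert G] = [set x | within r x].
  by apply/esym/seteqP; split=> [//|x _]; exact: hG.
elim: r {hG} => [|n IHn].
  apply: (@sub_finite_set _ _ [set root G]); last exact: finite_set1.
  by move=> x [p [_ <-]]; rewrite leqn0 size_eq0 => /eqP->.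
apply: (@sub_finite_set _ _ ([set root G] `|`
   \bigcup_(x in [set x : vert G | within n x]) [set y | adj x y])).
  move=> x [p [pp <- sp]]; case/lastP: p pp sp => [|p z]; first by left.
  rewrite rcons_path last_rcons size_rcons ltnS => /andP[pp e] sp; right.
  by exists (last (root G) p) => //; exists p.
by rewrite finite_setU; split; [exact: finite_set1|apply: bigcup_finite].
Qed.

Lemma finite_graph_enum G : finite_graph G ->
  exists n (b : 'I_n -> vert G), bijective b.
Proof.
move=> fG; set X := fset_set [set: vert G].
have XT x : x \in X by rewrite in_fset_set // inE.
exists #|` X|, (fun i => nth (root G) X i).
rewrite -setTT_bijective; split=> // [i k _ _ /eqP|x _].
  by rewrite nth_uniq ?fset_uniq // => /eqP/val_inj.
have ix : (index x X < #|` X|)%N by rewrite index_mem XT.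
by exists (Ordinal ix) => //=; rewrite nth_index.
Qed.
End Graphs.

(** * Attaching leaves to a rooted graph *)

Section AddLeaves.
Variables (G : rooted_graph) (j : nat) (alpha : {i : nat | (i < j)%N} -> vert G).

(** The leaves are indexed by [{i : nat | i < j}] because ['I_j] is not an admissible carrier for
    [vert]. *)
Definition add_leaves_adj (x y : vert G + {i : nat | (i < j)%N}) : bool :=
  match x, y with
  | inl x, inl y => adj x y
  | inl x, inr i | inr i, inl x => x == alpha i
  | inr _, inr _ => false
  end.

Lemma add_leaves_sym : symmetric add_leaves_adj.
Proof. by move=> [x|i] [y|k] //=; exact: adj_sym. Qed.

Lemma add_leaves_irr : irreflexive add_leaves_adj.
Proof. by move=> [x|i] //=; exact: adj_irr. Qed.

Definition add_leaves : rooted_graph :=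
  @RootedGraph (vert G + {i : nat | (i < j)%N}) (inl (root G))
    add_leaves_adj add_leaves_sym add_leaves_irr.

Lemma add_leaves_connected : connected_graph G -> connected_graph add_leaves.
Proof.
move=> cG.
have inl_within x : exists n, @within add_leaves n (inl x).
  have [n [p [pp <- sp]]] := cG x; exists n; exists (map inl p); split=> //.
  - by rewrite /= path_map.
  - by rewrite /= last_map.
  - by rewrite size_map.
case=> [|i]; first exact: inl_within.
have [n [p [pp lp sp]]] := inl_within (alpha i).
exists n.+1, (rcons p (inr i)); split.
- by rewrite rcons_path pp /= lp /= eqxx.
- by rewrite last_rcons.
- by rewrite size_rcons.
Qed.

(** A leaf has a single neighbour, so on a cycle its predecessor and successor coincide, against
    [uniq] once the length exceeds 2. A cycle without leaves lies in [G]. *)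
Lemma add_leaves_acyclic : acyclic_graph G -> acyclic_graph add_leaves.
Proof.
move=> aG c sc uc; apply/negP => cc.
pose is_leaf (x : vert add_leaves) := if x is inr _ then true else false.
have [/hasP[[//|i] ic _]|] := boolP (has is_leaf c).
  have [n s def_s] := rot_to ic.
  rewrite -(rot_uniq n) def_s in uc; rewrite -(size_rot n) def_s in sc.
  rewrite -(rot_cycle n) def_s in cc.
  case: s sc uc cc {def_s} => [|y s] // sc uc.
  rewrite /= rcons_path => /and3P[iy _ yi].
  have leaf z : add_leaves_adj (inr i) z -> z = inl (alpha i).
    by case: z => //= z /eqP->.
  rewrite add_leaves_sym in yi.
  have := leaf _ yi; rewrite -(leaf _ iy) => ly.
  case/lastP: s ly sc uc {yi} => // s z; rewrite last_rcons => ->.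
  by rewrite !cons_uniq mem_rcons mem_head /= andbF.
move=> /hasPn noleaf.
have [d def_c] : exists d, c = map inl d.
  elim: c noleaf {sc uc cc} => [|[x|i] c IHc] no; first by exists [::].
  - have [|d ->] := IHc; first by move=> y yc; apply: no; rewrite inE yc orbT.
    by exists (x :: d).
  - by have := no (inr i); rewrite inE eqxx => /(_ isT).
rewrite def_c in sc uc cc.
rewrite map_inj_uniq in uc; last by move=> ? ? [].
rewrite size_map in sc.
suff : cycle (@adj G) d by apply/negP; exact: aG.
case: (d) cc => //= x s; rewrite -(map_rcons inl s x) path_map.
by apply: sub_path.
Qed.

Lemma add_leaves_tree : is_tree G -> is_tree add_leaves.
Proof. by move=> [/add_leaves_connected ? /add_leaves_acyclic ?]. Qed.

End AddLeaves.

(** * Counting extensions of tree-maps over finite types *)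

Section FiniteCount.
Variables (A B : finType) (ra : A) (ea : rel A) (rb : B) (eb : rel B).

(** Tree-maps as finite functions, so that counting them becomes a sum over a finite type. *)
Definition fin_tree_map (phi : {ffun A -> B}) : bool :=
  [&& injectiveb phi, phi ra == rb & [forall x, forall y, ea x y ==> eb (phi x) (phi y)]].

(** These are the possible images of an attached leaf; their number is the b of the opening
    sketch. *)
Definition boundary (phi : {ffun A -> B}) : {set B} :=
  [set y | (y \notin codom phi) && [exists x, eb (phi x) y]]%SET.

Definition fin_add_leaves (j : nat) (alpha : {ffun 'I_j -> A}) : rel (A + 'I_j) :=
  fun x y => match x, y with
  | inl x, inl y => ea x y
  | inl x, inr i | inr i, inl x => x == alpha i
  | inr _, inr _ => false
  end.

Lemma fin_tree_mapP (phi : {ffun A -> B}) :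
  reflect [/\ injective phi, phi ra = rb & forall x y, ea x y -> eb (phi x) (phi y)]
    (fin_tree_map phi).
Proof.
apply: (iffP and3P) => -[h1 h2 h3]; split.
- exact/injectiveP.
- exact/eqP.
- by move=> x y; move/forallP: h3 => /(_ x)/forallP/(_ y)/implyP; apply.
- exact/injectiveP.
- exact/eqP.
- by apply/forallP => x; apply/forallP => y; apply/implyP; exact: h3.
Qed.
End FiniteCount.

(** A tree-map of the enlarged tree is a pair of a map [phi] and a placement [f] of the leaves.
    After exchanging the sums, each injective [f] into the boundary of [phi] is compatible with
    exactly one [alpha], and there are b ^_ j such [f]. *)
Lemma sum_fin_tree_map_add_leaves (A B : finType) (ra : A) (ea : rel A)
    (rb : B) (eb : rel B) (j : nat) :
  symmetric eb ->
  (forall phi, fin_tree_map ra ea rb eb phi -> forall y x x',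
     y \notin codom phi -> eb (phi x) y -> eb (phi x') y -> x = x') ->
  (\sum_(alpha : {ffun 'I_j -> A})
     #|[set psi | @fin_tree_map (A + 'I_j)%type B (inl ra) (fin_add_leaves ea alpha) rb eb psi]%SET|
   = \sum_(phi | fin_tree_map ra ea rb eb phi) #|boundary eb phi| ^_ j)%N.
Proof.
move=> eb_sym outer_unique.
pose join (p : {ffun A -> B} * {ffun 'I_j -> B}) : {ffun A + 'I_j -> B} :=
  [ffun x => match x with inl a => p.1 a | inr i => p.2 i end].
pose split_ (psi : {ffun A + 'I_j -> B}) : {ffun A -> B} * {ffun 'I_j -> B} :=
  ([ffun a => psi (inl a)], [ffun i => psi (inr i)]).
have joinK : cancel join split_.
  move=> [p f]; congr pair; apply/ffunP => i; by rewrite !ffunE.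
have splitK : cancel split_ join.
  move=> psi; apply/ffunP => -[a|i]; by rewrite !ffunE.
have joinP alpha phi f :
    fin_tree_map (inl ra) (fin_add_leaves ea alpha) rb eb (join (phi, f)) =
    [&& fin_tree_map ra ea rb eb phi, injectiveb f,
        [forall i, f i \notin codom phi] & [forall i, eb (phi (alpha i)) (f i)]].
  apply/fin_tree_mapP/and4P.
    move=> [inj r0 e]; split.
    - apply/fin_tree_mapP; split.
      + move=> x y xy; have : inl x = inl y :> A + 'I_j by apply: inj; rewrite !ffunE.
        by case.
      + by move: r0; rewrite !ffunE.
      + by move=> x y xy; have := e (inl x) (inl y) xy; rewrite !ffunE.
    - apply/injectiveP => x y xy; have : inr x = inr y :> A + 'I_j by apply: inj; rewrite !ffunE.
      by case.
    - apply/forallP => i; apply/codomP => -[x fx].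
      have : inr i = inl x :> A + 'I_j by apply: inj; rewrite !ffunE.
      by case.
    - by apply/forallP => i; have := e (inl (alpha i)) (inr i) (eqxx _); rewrite !ffunE.
  move=> [/fin_tree_mapP[inj r0 e] /injectiveP fi /forallP fo /forallP fa]; split.
  - have out i x : f i <> phi x by move=> fx; move: (fo i); rewrite fx codom_f.
    move=> [x|i] [y|k]; rewrite !ffunE /=.
    + by move=> /inj->.
    + by move=> /esym/out.
    + by move=> /out.
    + by move=> /fi->.
  - by rewrite ffunE.
  - move=> [x|i] [y|k] //=; rewrite !ffunE /=.
    + exact: e.
    + by move=> /eqP->.
    + by move=> /eqP->; rewrite eb_sym.
under [LHS]eq_bigr do rewrite -sum1dep_card big_mkcond /=.
rewrite exchange_big /=.
rewrite (reindex join) /=; last by exists split_ => p _.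
rewrite -(pair_bigA _ (fun phi f => \sum_alpha
  if fin_tree_map (inl ra) (fin_add_leaves ea alpha) rb eb (join (phi, f)) then 1 else 0)) /=.
rewrite [RHS]big_mkcond /=; apply: eq_bigr => phi _.
case: ifPn => phiP; last first.
  by rewrite big1 // => f _; rewrite big1 // => alpha _; rewrite joinP (negbTE phiP).
rewrite -[in RHS](card_ord j) -(card_inj_ffuns_on _ (mem (boundary eb phi))).
rewrite -sum1_card [RHS]big_mkcond /=; apply: eq_bigr => f _.
rewrite inE; case: ifPn => [/andP[/ffun_onP f_on f_inj]|f_off].
  (* Boundary membership supplies a parent for each leaf, and [outer_unique] makes the resulting
     [alpha] the only compatible one. *)
  have /fin_all_exists[a aP] i : exists x, eb (phi x) (f i).
    by have := f_on i; rewrite inE => /andP[_ /existsP].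
  rewrite (bigD1 (finfun a)) //= joinP phiP f_inj /=.
  have -> : [forall i, f i \notin codom phi].
    by apply/forallP => i; have := f_on i; rewrite inE => /andP[].
  have -> /= : [forall i, eb (phi ([ffun x => a x] i)) (f i)].
    by apply/forallP => i; rewrite ffunE.
  rewrite big1 ?addn0 // => alpha /eqP na; rewrite joinP.
  case: ifP => // /and4P[_ _ /forallP fo /forallP fa]; case: na.
  by apply/ffunP => i; rewrite ffunE; apply: outer_unique (fo i) (fa i) (aP i).
(* A compatible [alpha] would force [f] to be injective into the boundary. *)
rewrite big1 // => alpha _; rewrite joinP; case: ifP => // /and4P[_ fi /forallP fo /forallP fa].
case/negP: f_off; rewrite fi andbT; apply/ffun_onP => i; rewrite inE fo /=.
by apply/existsP; exists (alpha i).
Qed.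

(** Conjugation by the enumerations [a] and [b] matches the two sets of maps. *)
Lemma num_tree_map_fin (G H : rooted_graph) (A B : finType) (a : A -> vert G) (b : B -> vert H)
    (ra : A) (ea : rel A) (rb : B) (eb : rel B) :
  bijective a -> bijective b -> a ra = Defs.root G -> b rb = Defs.root H ->
  (forall x y, adj (a x) (a y) = ea x y) -> (forall x y, adj (b x) (b y) = eb x y) ->
  num_tree_map H G = #|[set phi | fin_tree_map ra ea rb eb phi]%SET|.
Proof.
move=> [a' aK a'K] [b' bK b'K] ar br aE bE.
pose h (phi : {ffun A -> B}) (x : vert G) := b (phi (a' x)).
have h_inj : injective h.
  move=> f g fg; apply/ffunP => x; apply: (can_inj bK).
  by have := congr1 (fun u => u (a x)) fg; rewrite /h aK.
set S := [set phi | _]%SET.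
have -> : num_tree_map H G = #|` (h @` [fset x in enum S])%fset|.
  rewrite /num_tree_map; congr (#|` _|); rewrite -[RHS]set_fsetK; congr fset_set.
  apply/seteqP; split=> [f [fi f0 fe]|f] /=.
    apply/imfsetP; exists [ffun x => b' (f (a x))]; last first.
      by apply/funext => x; rewrite /h ffunE a'K b'K.
    rewrite /= inE mem_enum inE; apply/fin_tree_mapP; split.
    - by move=> x y; rewrite !ffunE => /(can_inj b'K)/fi/(can_inj aK).
    - by rewrite ffunE ar f0 -br bK.
    - by move=> x y; rewrite !ffunE -aE -bE !b'K; exact: fe.
  move=> /imfsetP[phi /=]; rewrite inE mem_enum inE => /fin_tree_mapP[pi p0 pe] ->; split.
  - by move=> x y /(can_inj bK)/pi/(can_inj a'K).
  - by rewrite /h -ar aK p0.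
  - by move=> x y xy; rewrite /h bE; apply: pe; rewrite -aE !a'K.
by rewrite card_imfset //= card_fseq undup_id ?enum_uniq // -cardE.
Qed.

Lemma num_vert_bij (G : rooted_graph) (A : finType) (a : A -> vert G) :
  bijective a -> finite_graph G /\ num_vert G = #|A|.
Proof.
move=> [a' aK a'K]; have aT : [set: vert G] = [set` (a @` [fset x in enum A])%fset].
  apply/seteqP; split=> x //= _; apply/imfsetP; exists (a' x) => //=.
  by rewrite inE mem_enum.
split; first by rewrite /finite_graph aT; exact: finite_fset.
rewrite /num_vert aT set_fsetK card_imfset //=; last exact: can_inj aK.
by rewrite card_fseq undup_id ?enum_uniq // -cardE.
Qed.

(** * Leaf sums of a fixed finite tree *)

Section LeafCount.
Variables (G : rooted_graph) (n : nat) (b : 'I_n -> vert G).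
Hypothesis b_bij : bijective b.

Definition leaf_parent (j : nat) (alpha : {ffun 'I_j -> 'I_n}) (i : {i : nat | (i < j)%N}) :
  vert G := b (alpha (Ordinal (svalP i))).

Definition add_leaves_enum (j : nat) (alpha : {ffun 'I_j -> 'I_n}) (x : 'I_n + 'I_j) :
    vert (add_leaves (leaf_parent alpha)) :=
  match x with
  | inl x => inl (b x)
  | inr i => inr (exist _ (val i) (ltn_ord i))
  end.

Lemma add_leaves_enum_bij j (alpha : {ffun 'I_j -> 'I_n}) : bijective (add_leaves_enum alpha).
Proof.
have [b' bK b'K] := b_bij.
exists (fun x : vert (add_leaves (leaf_parent alpha)) => match x with
  | inl x => inl (b' x) | inr i => inr (Ordinal (svalP i)) end).
- by move=> [x|i] /=; [rewrite bK|congr inr; exact: val_inj].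
- by move=> [x|i] /=; [rewrite b'K|congr inr; exact: val_inj].
Qed.

Lemma finite_add_leaves j (alpha : {ffun 'I_j -> 'I_n}) :
  finite_graph (add_leaves (leaf_parent alpha)) /\
  num_vert (add_leaves (leaf_parent alpha)) = (n + j)%N.
Proof.
have [? ->] := num_vert_bij (add_leaves_enum_bij alpha).
by rewrite card_sum !card_ord.
Qed.

(** [s] lists the boundary sizes of all tree-maps from [G] to [H]. A zero means that the image is
    closed under adjacency, so the map is surjective and [G] and [H] are isomorphic; conversely an
    isomorphism leaves no vertex outside its image. *)
Lemma num_tree_map_add_leaves (H : rooted_graph) :
  is_tree G -> is_tree H -> finite_graph H ->
  exists s : seq nat,
    (forall j, \sum_(alpha : {ffun 'I_j -> 'I_n})
        num_tree_map H (add_leaves (leaf_parent alpha)) = \sum_(c <- s) c ^_ j)%N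
    /\ (0%N \in s <-> rooted_iso G H).
Proof.
move=> [cG aG] [cH aH] /finite_graph_enum[m [d [d' dK d'K]]].
have [b' bK b'K] := b_bij.
pose ea x y := adj (b x) (b y); pose eb x y := adj (d x) (d y).
pose ra := b' (Defs.root G); pose rb := d' (Defs.root H).
pose lift (phi : {ffun 'I_n -> 'I_m}) x := d (phi (b' x)).
have liftP phi : fin_tree_map ra ea rb eb phi -> tree_map G H (lift phi).
  move=> /fin_tree_mapP[pi p0 pe]; split.
  - by move=> x y /(can_inj dK)/pi/(can_inj b'K).
  - by rewrite /lift -/ra p0 /rb d'K.
  - by move=> x y xy; apply: pe; rewrite /ea !b'K.
exists [seq #|boundary eb phi| | phi <- enum (fin_tree_map ra ea rb eb)]; split.
  move=> j; rewrite big_map big_enum /=.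
  rewrite -[RHS]/(\sum_(phi | fin_tree_map ra ea rb eb phi) #|boundary eb phi| ^_ j)%N.
  rewrite -sum_fin_tree_map_add_leaves; first last.
  - move=> phi phiP y x x' yo xy x'y; apply: (can_inj bK).
    apply: (tree_map_outer_unique cG aH (liftP _ phiP) (y := d y)).
    + move=> z; apply/eqP => /(can_inj dK) zy.
      by move: yo; rewrite -zy codom_f.
    + by rewrite /lift bK.
    + by rewrite /lift bK.
  - by move=> x y; rewrite /eb adj_sym.
  apply: eq_bigr => alpha _.
  apply: (num_tree_map_fin (add_leaves_enum_bij alpha)) => //=.
  - by exists d'.
  - by rewrite b'K.
  - by rewrite d'K.
  - move=> [x|i] [y|k] //=; rewrite (can_eq bK); congr (_ == alpha _); exact: val_inj.
split.
  move=> /mapP[phi]; rewrite mem_enum => phiP /esym/eqP; rewrite cards_eq0 => /eqP p0.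
  apply: (surjective_tree_map_iso cG aH (liftP _ phiP)).
  have [_ l0 _] := liftP _ phiP.
  apply: (connected_closed_surj cH l0) => x y xy.
  have : d' y \notin boundary eb phi by rewrite p0 inE.
  rewrite inE negb_and negbK => /orP[/codomP[z yz]|/existsP[]].
    by exists (b z); rewrite /lift bK -yz d'K.
  by exists (b' x); rewrite /eb d'K.
move=> [f [[f' fK f'K] f0 fa]].
apply/mapP; exists [ffun x => d' (f (b x))].
  rewrite mem_enum; apply/fin_tree_mapP; split.
  - by move=> x y; rewrite !ffunE => /(can_inj d'K)/(can_inj fK)/(can_inj bK).
  - by rewrite ffunE b'K f0.
  - by move=> x y; rewrite !ffunE /eb !d'K fa.
apply/esym/eqP; rewrite cards_eq0; apply/eqP/setP => y; rewrite !inE.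
rewrite (_ : y \in _) //; apply/codomP; exists (b' (f' (d y))).
by rewrite ffunE b'K f'K dK.
Qed.
End LeafCount.

(** * The space of trees is countable and discrete *)

Section TreeSpace.
Variable r : nat.
Implicit Types u v : tree_class r.

Lemma tree_class_finite u : finite_graph (tree_class_repr u).
Proof. by have [_ lf h] := lf_treeP (tree_class_repr u); exact: finite_height_le lf h. Qed.

Lemma tree_class_iso u v : rooted_iso (tree_class_repr u) (tree_class_repr v) -> u = v.
Proof.
move=> uv; rewrite -[u]reprK -[v]reprK; apply/eqmodP; exact/asboolP.
Qed.

Lemma rooted_ball_iso (G : rooted_graph) : height_le r G -> rooted_iso (rooted_ball r G) G.
Proof.
move=> hG; exists val; split=> //.
exists (fun x => exist _ x (asboolT (hG x))) => [x|//]; exact: val_inj.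
Qed.

(** The ball of radius [r] is the whole tree, so it already determines the class. *)
Lemma local_cylinder_eq u : local_cylinder r u = [set u].
Proof.
have h (w : tree_class r) : height_le r (tree_class_repr w).
  by have [] := lf_treeP (tree_class_repr w).
apply/seteqP; split=> [v|v ->]; last exact: rooted_iso_refl.
move=> vu; apply: tree_class_iso.
apply: rooted_iso_trans (rooted_ball_iso (h u)).
by apply: rooted_iso_trans vu; apply: rooted_iso_sym; exact: rooted_ball_iso.
Qed.

(** A class is encoded by its number of vertices, the index of the root and the adjacency table in
    some enumeration. Two classes with the same code are isomorphic through their enumerations. *)
Lemma countable_tree_class : countable [set: tree_class r].
Proof.
pose code := {n : nat & ('I_n * {ffun 'I_n * 'I_n -> bool})%type}.
pose codes (c : code) (G : rooted_graph) := exists b : 'I_(tag c) -> vert G,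
  [/\ bijective b, b (tagged c).1 = Defs.root G
    & forall x y, adj (b x) (b y) = (tagged c).2 (x, y)].
have /choice[f f_codes] u : exists c, codes c (tree_class_repr u).
  have [n [b [b' bK b'K]]] := finite_graph_enum (tree_class_finite u).
  exists (Tagged (fun n => 'I_n * {ffun 'I_n * 'I_n -> bool})%type
    (b' (Defs.root _), [ffun p => adj (b p.1) (b p.2)])).
  exists b; split; first by exists b'.
  - by rewrite /= b'K.
  - by move=> x y; rewrite /= ffunE.
apply/countable_injP; exists (choice.pickle \o f) => u v _ _ /(pcan_inj choice.pickleK) fuv.
apply: tree_class_iso.
have [b [[b' bK b'K] b0 bE]] := f_codes u.
have := f_codes v; rewrite -fuv => -[c [[c' cK c'K] c0 cE]].
exists (c \o b'); split.
- by apply: bij_comp; [exists c'|exists b].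
- by rewrite /= -b0 bK.
- by move=> x y; rewrite /= cE -bE !b'K.
Qed.

(** Singletons are cylinders and every set is countable. All measurability questions about functions
    of [U] reduce to this. *)
Lemma measurable_tree_space (A : set (tree_space r)) : measurable A.
Proof.
apply: countable_measurable; last first.
  exact: sub_countable (subset_card_le (@subsetT _ _)) countable_tree_class.
move=> u; rewrite -(local_cylinder_eq u).
by apply: sub_sigma_algebra; exists r, u.
Qed.
End TreeSpace.

(** * Even and odd binomial sums, and their series *)

Lemma sum_bin_even_odd c m : (c <= m.*2)%N ->
  (\sum_(j < m.+1) 'C(c, j.*2) = (c == 0) + \sum_(j < m.+1) 'C(c, j.*2.+1))%N.
Proof.
case: c => [_|c cm].
  by rewrite big_ord_recl big1 ?addn0 //= big1 // => i _; rewrite bin0n.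
(* By Pascal's rule the alternating row sum stopped at index 2N telescopes to ['C(c, N.*2)]. *)
have telescope N : (\sum_(j < N.+1) 'C(c.+1, j.*2) =
    \sum_(j < N) 'C(c.+1, j.*2.+1) + 'C(c, N.*2))%N.
  elim: N => [|N IHN]; first by rewrite big_ord1 big_ord0 !bin0.
  by rewrite big_ord_recr IHN [in RHS]big_ord_recr /= doubleS !binS; lia.
(* The one remaining odd term also equals ['C(c, m.*2)], by Pascal's rule and [c < m.*2.+1]. *)
by rewrite telescope [RHS]big_ord_recr /= binS (@bin_small c m.*2.+1) // ltnW.
Qed.

(** This is sum_j (-1)^j 'C(c, j) = (c == 0) added up over [s], with the negative terms moved to the
    right so that only nonnegative series occur. *)
Lemma nneseries_even_odd_bin (R : realType) (s : seq nat) :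
  (\sum_(0 <= j <oo) ((\sum_(c <- s) 'C(c, j.*2))%N%:R : R)%:E =
   ((count_mem 0%N s)%:R : R)%:E
   + \sum_(0 <= j <oo) ((\sum_(c <- s) 'C(c, j.*2.+1))%N%:R : R)%:E)%E.
Proof.
pose m := (\max_(c <- s) c)%N.
have sm c : c \in s -> (c <= m.*2)%N.
  move=> cs; apply: (@leq_trans m); last by rewrite -addnn leq_addr.
  by rewrite /m; apply/leq_bigmax_seq.
(* Past index [m] all the binomials vanish, so both series are finite sums. *)
have fin (f : nat -> nat) : (forall j, j <= f j)%N -> (forall j, m < j -> m.*2 < f j)%N ->
    (\sum_(0 <= j <oo) ((\sum_(c <- s) 'C(c, f j))%N%:R : R)%:E =
     (\sum_(c <- s) \sum_(j < m.+1) 'C(c, f j))%N%:R%:E)%E.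
  move=> jf mf; rewrite (nneseries_split 0 m.+1) => [|k _]; last by rewrite lee_fin.
  rewrite add0n eseries0 ?adde0 => [|j mj _].
    by rewrite sumEFin -natr_sum big_mkord exchange_big.
  by rewrite big_seq big1 // => c cs; rewrite bin_small // (leq_ltn_trans (sm _ cs)) // mf.
rewrite (fin double) ?(fin (fun j => j.*2.+1)); try by lia.
rewrite -EFinD -natrD; congr (_%:R%:E).
rewrite -sum1_count [in RHS]big_mkcond -big_split /= big_seq [RHS]big_seq.
apply: eq_bigr => c cs; rewrite sum_bin_even_odd ?sm //.
Qed.

(** Comparison with [C] times the convergent exponential series at [x]. *)
Lemma nneseries_le_exp_coeff (R : realType) (C x : R) (e : nat -> \bar R) :
  (0 <= C)%R -> (0 <= x)%R -> (forall j, 0 <= e j)%E ->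
  (forall j, e j <= (C * exp_coeff x j)%:E)%E ->
  (\sum_(0 <= j <oo) e j < +oo)%E.
Proof.
move=> C0 x0 e0 eC.
apply: (@le_lt_trans _ _ (\sum_(0 <= j <oo) (C * exp_coeff x j)%:E)%E).
  by apply: lee_nneseries.
under eq_eseriesr do rewrite EFinM.
rewrite nneseriesZl => [|j _]; last by rewrite lee_fin exp_coeff_ge0.
suff -> : (\sum_(0 <= j <oo) (exp_coeff x j)%:E = (limn (series (exp_coeff x)))%:E)%E.
  by rewrite -EFinM ltry.
rewrite -EFin_lim; last exact: is_cvg_series_exp_coeff.
by congr (limn _); apply/funext => n /=; rewrite sumEFin.
Qed.

(** * Integrating the leaf sums *)

Section Moments.
Variables (R : realType) (r : nat).
Local Open Scope ring_scope.
Local Open Scope ereal_scope.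

Lemma measurable_preimage_tree_RV (d : measure_display) (T : measurableType d)
    (P : probability T R) (U : {RV P >-> tree_space r}) (A : set (tree_space r)) :
  measurable (U @^-1` A).
Proof.
by rewrite -[_ @^-1` _]setTI; apply: measurable_funPT => //; exact: measurable_tree_space.
Qed.

Lemma measurable_fun_tree_RV (d : measure_display) (T : measurableType d)
    (P : probability T R) (U : {RV P >-> tree_space r})
    (d' : measure_display) (V : sigmaRingType d') (f : tree_space r -> V) :
  measurable_fun setT (fun w => f (U w)).
Proof. by move=> _ Y _; rewrite setTI; exact: (measurable_preimage_tree_RV U (f @^-1` Y)). Qed.

(** Attaching leaves can produce a tree of height r + 1, about which the hypotheses of the theorem
    are silent. Its moment vanishes because it has no tree-map into [U]. *)
Lemma expectation_num_tree_map_eq0 (d : measure_display) (T : measurableType d)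
    (P : probability T R) (U : {RV P >-> tree_space r}) (t : rooted_graph) :
  is_tree t -> ~ height_le r t ->
  'E_P[fun w => (num_tree_map (tree_space_graph (U w)) t)%:R] = 0.
Proof.
move=> [ct _] ht; rewrite (_ : (fun w => _) = cst 0%R) ?expectation_cst //.
apply/funext => w /=; rewrite /num_tree_map (_ : tree_map _ _ = set0) ?fset_set0 //.
rewrite -subset0 => f ft; apply: ht.
have [[_ aU] _ hU] := lf_treeP (tree_class_repr (U w)).
exact: tree_map_height_le ct aU ft hU.
Qed.

Variables (u : tree_class r) (n : nat) (b : 'I_n -> vert (tree_class_repr u)).
Hypothesis b_bij : bijective b.

(** The mean of S_j(U) / j! in the notation of the opening sketch. *)
Definition leaf_moment (d : measure_display) (T : measurableType d)
    (P : probability T R) (U : {RV P >-> tree_space r}) (j : nat) : \bar R :=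
  (j`!%:R^-1)%:E * \sum_(alpha : {ffun 'I_j -> 'I_n})
    'E_P[fun w => (num_tree_map (tree_space_graph (U w)) (add_leaves (leaf_parent b alpha)))%:R].

Lemma leaf_moment_ge0 d T P U j : 0 <= @leaf_moment d T P U j.
Proof.
apply: mule_ge0; first by rewrite lee_fin invr_ge0.
by apply: sume_ge0 => alpha _; apply: expectation_ge0 => w.
Qed.

(** Integrate [nneseries_even_odd_bin] termwise, which nonnegativity permits even when the sums are
    infinite. The constant [c], the multiplicity of 0 in [s u], is fixed before the random variable,
    so the same one serves two different laws. *)
Lemma leaf_moment_even_odd : exists2 c : nat, (0 < c)%N &
  forall (d : measure_display) (T : measurableType d) (P : probability T R)
    (U : {RV P >-> tree_space r}),
  \sum_(0 <= j <oo) leaf_moment U j.*2 = c%:R%:E * distribution P U [set u] +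
  \sum_(0 <= j <oo) leaf_moment U j.*2.+1.
Proof.
have /choice[s s_count] v : exists s : seq nat,
    (forall j, \sum_(alpha : {ffun 'I_j -> 'I_n})
        num_tree_map (tree_class_repr v) (add_leaves (leaf_parent b alpha))
      = \sum_(c <- s) c ^_ j)%N /\ (0%N \in s <-> v = u).
  have [tu _ _] := lf_treeP (tree_class_repr u).
  have [tv _ _] := lf_treeP (tree_class_repr v).
  have [s [s_sum s0]] := num_tree_map_add_leaves b_bij tu tv (tree_class_finite v).
  exists s; split=> //; rewrite s0; split=> [uv|->]; last exact: rooted_iso_refl.
  by apply/esym/tree_class_iso.
exists (count_mem 0%N (s u)).
  by rewrite -has_count has_pred1; have [_ [_ ->]] := s_count u.
move=> d T P U.
have emeas (f : tree_space r -> \bar R) : measurable_fun setT (fun w => f (U w)).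
  exact: measurable_fun_tree_RV.
have meas (f : tree_space r -> R) : measurable_fun setT (fun w => (f (U w))%:E).
  exact: (emeas (fun v => (f v)%:E)).
(* Division by j! turns the falling factorials of [s_count] into binomials. *)
have leaf_momentE j : leaf_moment U j = \int[P]_w ((\sum_(c <- s (U w)) 'C(c, j))%N%:R : R)%:E.
  rewrite /leaf_moment; under eq_bigr do rewrite unlock.
  rewrite -ge0_integral_sum //; last first.
    move=> alpha.
    exact: (meas (fun v => (num_tree_map (tree_space_graph v) _)%:R)).
  rewrite -ge0_integralZl_EFin //; first last.
  - exact: (emeas (fun v => \sum_(alpha <- _)
      (num_tree_map (tree_space_graph v) (add_leaves (leaf_parent b alpha)))%:R%:E)).
  - by move=> w _; apply: sume_ge0.
  apply: eq_integral => w _; rewrite sumEFin -natr_sum; have [-> _] := s_count (U w).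
  under eq_bigr do rewrite -bin_ffact.
  rewrite -big_distrl /= natrM -EFinM mulrC mulfK // pnatr_eq0 -lt0n fact_gt0 //.
under eq_eseriesr do rewrite leaf_momentE.
under [in RHS]eq_eseriesr do rewrite leaf_momentE.
rewrite -integral_nneseries //; last first.
  by move=> j; apply: (meas (fun v => (\sum_(c <- s v) 'C(c, j.*2))%N%:R)).
rewrite -integral_nneseries //; last first.
  by move=> j; apply: (meas (fun v => (\sum_(c <- s v) 'C(c, j.*2.+1))%N%:R)).
under eq_integral do rewrite nneseries_even_odd_bin.
rewrite ge0_integralD //; first last.
- exact: (emeas (fun v => \sum_(0 <= j <oo) ((\sum_(c <- s v) 'C(c, j.*2.+1))%N%:R : R)%:E)).
- by move=> w _; apply: nneseries_ge0.
- exact: (meas (fun v => (count_mem 0%N (s v))%:R)).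
congr (_ + _).
(* A zero occurs in [s (U w)] only when [U w = u]. *)
transitivity (\int[P]_w ((count_mem 0%N (s u))%:R%:E * (\1_(U @^-1` [set u]) w)%:E : \bar R)).
  apply: eq_integral => w _; rewrite indicE -EFinM; congr EFin.
  have [Uu|Uu] := pselect (U w = u); first by rewrite (@mem_set _ (U @^-1` [set u]) w Uu) mulr1 Uu.
  rewrite (@memNset _ (U @^-1` [set u]) w) // mulr0 (_ : count_mem _ _ = 0%N) //; apply/eqP.
  rewrite -leqn0 leqNgt -has_count has_pred1; apply/negP.
  by have [_ [h _]] := s_count (U w) => /h.
have mu : measurable (U @^-1` [set u]).
  exact: measurable_preimage_tree_RV.
rewrite ge0_integralZl_EFin //; last exact/measurable_EFinP/measurable_indic.
by rewrite integral_indic // setIT.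
Qed.

(** There are n^j choices of [alpha], each giving a tree with n + j vertices, so the j-th leaf
    moment is at most e^(k n) x^j / j! with x = n e^k. *)
Lemma leaf_moment_odd_lt_pinfty (k : R) (d : measure_display) (T : measurableType d)
    (P : probability T R) (U : {RV P >-> tree_space r}) :
  (forall t : rooted_graph, is_tree t -> finite_graph t -> height_le r t ->
     'E_P[fun w => (num_tree_map (tree_space_graph (U w)) t)%:R]
       <= (expR (k * (num_vert t)%:R))%:E) ->
  \sum_(0 <= j <oo) leaf_moment U j.*2.+1 < +oo.
Proof.
move=> moment_bound; pose x := (n%:R * expR k : R)%R.
have x0 : (0 <= x)%R by rewrite mulr_ge0 ?expR_ge0.
have bound j : leaf_moment U j <= (expR (k * n%:R) * (j`!%:R^-1 * x ^+ j))%:E.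
  have -> : (expR (k * n%:R) * (j`!%:R^-1 * x ^+ j) =
      j`!%:R^-1 * \sum_(alpha : {ffun 'I_j -> 'I_n}) expR (k * (n + j)%:R))%R.
    rewrite sumr_const card_ffun !card_ord natrD mulrDr expRD !expRM_natr.
    by rewrite -[(_ *+ (_ ^ _))%R]mulr_natl natrX /x exprMn; ring.
  rewrite EFinM /leaf_moment -sumEFin lee_wpmul2l ?lee_fin ?invr_ge0 //.
  apply: lee_sum => alpha _.
  have [fin <-] := finite_add_leaves b_bij alpha.
  have tr : is_tree (add_leaves (leaf_parent b alpha)).
    by apply: add_leaves_tree; have [] := lf_treeP (tree_class_repr u).
  have [ht|ht] := pselect (height_le r (add_leaves (leaf_parent b alpha))).
    exact: moment_bound.
  by rewrite expectation_num_tree_map_eq0 // lee_fin expR_ge0.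
(* Since x^(2j+1) / (2j+1)! <= x (x^2)^j / j!, the exponential series at x^2 dominates the odd
   terms. *)
apply: (@nneseries_le_exp_coeff _ (expR (k * n%:R) * x) (x ^+ 2)).
- by rewrite mulr_ge0 ?expR_ge0.
- by rewrite exprn_ge0.
- by move=> j; exact: leaf_moment_ge0.
move=> j; apply: le_trans (bound _) _; rewrite lee_fin exp_coeffE /=.
rewrite -mulrA ler_wpM2l ?expR_ge0 // exprS -muln2 mulnC exprM mulrCA ler_wpM2l //.
rewrite ler_wpM2r ?exprn_ge0 // lef_pV2 ?posrE ?ltr0n ?fact_gt0 // ler_nat.
by apply: leq_fact; lia.
Qed.
End Moments.

(** * Uniqueness of the law *)

Local Open Scope ring_scope.
Local Open Scope ereal_scope.

(** [U] and [U'] have the same leaf moments, so [leaf_moment_even_odd] gives the same equation for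
    both probabilities; cancel the odd sum and divide by [c]. *)
Lemma distribution_set1_determined (R : realType) (r : nat) (k : R)
    (d : measure_display) (T : measurableType d) (P : probability T R)
    (U : {RV P >-> tree_space r})
    (d' : measure_display) (T' : measurableType d') (P' : probability T' R)
    (U' : {RV P' >-> tree_space r}) (u : tree_space r) :
  (forall t : rooted_graph, is_tree t -> finite_graph t -> height_le r t ->
     'E_P[fun w => (num_tree_map (tree_space_graph (U w)) t)%:R]
       <= (expR (k * (num_vert t)%:R))%:E)%E ->
  (forall t : rooted_graph, is_tree t -> finite_graph t -> height_le r t ->
     'E_P'[fun w => (num_tree_map (tree_space_graph (U' w)) t)%:R]
       = 'E_P[fun w => (num_tree_map (tree_space_graph (U w)) t)%:R])%E ->
  distribution P' U' [set u] = distribution P U [set u].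
Proof.
move=> moment_bound same.
have [n [b b_bij]] := finite_graph_enum (tree_class_finite u).
have [c c0 evenodd] := @leaf_moment_even_odd R r u n b b_bij.
have fin := leaf_moment_odd_lt_pinfty b_bij moment_bound.
have leafE : leaf_moment b U' = leaf_moment b U.
  apply/funext => j; rewrite /leaf_moment; congr (_ * _)%E; apply: eq_bigr => alpha _.
  have tr : is_tree (add_leaves (leaf_parent b alpha)).
    by apply: add_leaves_tree; have [] := lf_treeP (tree_class_repr u).
  have [ht|ht] := pselect (height_le r (add_leaves (leaf_parent b alpha))).
    by apply: same => //; have [] := finite_add_leaves b_bij alpha.
  by rewrite !expectation_num_tree_map_eq0.
have := evenodd _ _ _ U'; rewrite leafE (evenodd _ _ _ U).
set S := (\sum_(0 <= j <oo) _)%E in fin *.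
(* Cancellation in the extended reals needs a finite [S]. The bound is assumed for [U] only and
   reaches [U'] through [leafE]. *)
have Sfin : S \is a fin_num.
  by rewrite ge0_fin_numE // nneseries_ge0 // => *; exact: leaf_moment_ge0.
move=> /(congr1 (fun x => x - S)%E); rewrite !addeK // => /esym/eqP.
have c_neq0 : (c%:R != 0 :> R)%R by rewrite pnatr_eq0 -lt0n.
by rewrite -eqe_pdivrMl // muleA -EFinM mulVf // mul1e => /eqP.
Qed.

(** An injection of the classes into the naturals cuts [A] into countably many disjoint pieces, each
    empty or a singleton, and countable additivity applies. *)
Lemma distribution_tree_space_eq (R : realType) (r : nat)
    (d : measure_display) (T : measurableType d) (P : probability T R)
    (U : {RV P >-> tree_space r})
    (d' : measure_display) (T' : measurableType d') (P' : probability T' R)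
    (U' : {RV P' >-> tree_space r}) :
  (forall u, distribution P' U' [set u] = distribution P U [set u]) ->
  forall A, distribution P' U' A = distribution P U A.
Proof.
move=> eq1 A; have [f f_inj] := countable_injP _ (countable_tree_class r).
pose F i := A `&` f @^-1` [set i].
have FA : A = \bigcup_(i in setT) F i.
  by apply/seteqP; split=> [u Au|u [i _ [] //]]; exists (f u).
have F_triv : trivIset setT F.
  by move=> i j _ _ [u [[_ <-] [_ <-]]].
have mF (B : set (tree_space r)) : measurable B by exact: measurable_tree_space.
rewrite FA !measure_bigcup //; apply: eq_eseriesr => i _.
have [->|/set0P[u [Au fu]]] := eqVneq (F i) set0; first by rewrite !measure0.
have -> : F i = [set u]; last exact: eq1.
apply/seteqP; split=> [v [_ fv]|v ->//]; apply: f_inj; rewrite ?inE //.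
by rewrite fv fu.
Qed.

Theorem theorem8p8 (R : realType) (r : nat) (r_gt0 : (0 < r)%N)
    (d : measure_display) (T : measurableType d) (P : probability T R)
    (U : {RV P >-> tree_space r})
    (k : R)
    (moment_bound : forall t : rooted_graph,
       is_tree t -> finite_graph t -> height_le r t ->
       'E_P[fun w => (num_tree_map (tree_space_graph (U w)) t)%:R]
         <= (expR (k * (num_vert t)%:R))%:E)
    (d' : measure_display) (T' : measurableType d') (P' : probability T' R)
    (U' : {RV P' >-> tree_space r})
    (same_moments : forall t : rooted_graph,
       is_tree t -> finite_graph t -> height_le r t ->
       'E_P'[fun w => (num_tree_map (tree_space_graph (U' w)) t)%:R]
         = 'E_P[fun w => (num_tree_map (tree_space_graph (U w)) t)%:R])
    (A : set (tree_space r)) (measurable_A : measurable A) :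
  distribution P' U' A = distribution P U A.
Proof.
apply: distribution_tree_space_eq => u.
exact: distribution_set1_determined moment_bound same_moments.
Qed.
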